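(* Let $\Omega\subset\mathbb{R}^2$ be a region of finite area $|\Omega|$ and let $T\subset\Omega$ be a convex polygon with area $|T|$ and perimeter length $L(T)$. Fix $r_{max}>0$ and assume that every point within distance $r_{max}$ of $T$ lies in $\Omega$. A directional distance sensor is placed at a location $(x,y)$ uniformly distributed in $\Omega$ with direction $\theta$ uniformly distributed in $[0,2\pi)$, independently. Its measured distance is $s=\min\{t\in[0,r_{max}] : (x+t\cos\theta,\,y+t\sin\theta)\in T\}$ if this set is nonempty, and $s=\emptyset$ (no detection) otherwise. Then for every $0\le r\le r_{max}$, $$\Pr(s\le r)=\frac{r\,L(T)+\pi |T|}{\pi |\Omega|},$$ where the event $s\le r$ excludes the no-detection outcome.
   Context: In particular $s=0$ when the sensor lies in $T$. Probabilities are geometric probabilities: the probability of a set $X$ of sensor positions $(x,y,\theta)$ equals $\iiint_X dx\,dy\,d\theta/(2\pi|\Omega|)$. *)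

(* Defs.v *)
From HB Require Import structures.
From mathcomp Require Import all_boot all_order all_algebra.
From mathcomp Require Import all_classical all_reals all_analysis.
Set Implicit Arguments. Unset Strict Implicit. Unset Printing Implicit Defensive.
Import Order.TTheory GRing.Theory Num.Theory.
Import numFieldNormedType.Exports.
Local Open Scope classical_set_scope.
Local Open Scope ring_scope.

Section Defs.
Variable R : realType.

Definition dist2 (p q : R * R) : R :=
  Num.sqrt ((p.1 - q.1) ^+ 2 + (p.2 - q.2) ^+ 2).

Definition cross3 (a b c : R * R) : R :=
  (b.1 - a.1) * (c.2 - a.2) - (b.2 - a.2) * (c.1 - a.1).

(* v 0, ..., v (n-1) are the vertices of a (non-degenerate) convex polygon,
   listed counterclockwise: every other vertex lies strictly to the left
   of each directed edge v i -> v ((i+1) mod n). *)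
Definition convex_polygon_vertices (n : nat) (v : nat -> R * R) : Prop :=
  (3 <= n)%N /\
  forall i j, (i < n)%N -> (j < n)%N -> j <> i -> j <> ((i.+1) %% n)%N ->
    0 < cross3 (v i) (v ((i.+1) %% n)%N) (v j).

Definition polygon (n : nat) (v : nat -> R * R) : set (R * R) :=
  [set p | exists w : nat -> R,
     (forall i, 0 <= w i) /\ \sum_(i < n) w i = 1 /\
     p = (\sum_(i < n) w i * (v i).1, \sum_(i < n) w i * (v i).2)].

Definition perimeter (n : nat) (v : nat -> R * R) : R :=
  \sum_(i < n) dist2 (v i) (v ((i.+1) %% n)%N).

Definition area (A : set (R * R)) : \bar R :=
  ((@lebesgue_measure R) \x (@lebesgue_measure R))%E A.

Definition vol3 (A : set ((R * R) * R)) : \bar R :=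
  ((((@lebesgue_measure R) \x (@lebesgue_measure R))%E) \x (@lebesgue_measure R))%E A.

Definition hit_set (T : set (R * R)) (rmax : R) (p : R * R) (th : R) : set R :=
  [set t | 0 <= t <= rmax /\
           T (p.1 + t * cos th, p.2 + t * sin th)].

Definition detect_le (T : set (R * R)) (rmax r : R) (p : R * R) (th : R) : Prop :=
  exists s, hit_set T rmax p th s /\
            (forall t, hit_set T rmax p th t -> s <= t) /\ s <= r.

Definition prob_detect_le (Omega T : set (R * R)) (rmax r : R) : \bar R :=
  (vol3 [set z | Omega z.1 /\ (0 <= z.2 < 2 * pi)%R /\ detect_le T rmax r z.1 z.2]
   / ((2 * pi)%:E * area Omega))%E.

End Defs.

(* Main.v *)
Require Import Defs.
From HB Require Import structures.
From mathcomp Require Import all_boot all_order all_algebra.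
From mathcomp Require Import all_classical all_reals all_analysis.
From mathcomp Require Import measurable_realfun.
From mathcomp Require Import ring lra.
Import Order.TTheory GRing.Theory Num.Theory.
Import numFieldNormedType.Exports.
Local Open Scope classical_set_scope.
Local Open Scope ring_scope.

(** For a fixed direction u the detecting positions form the sweep
    T + [-r, 0] u.  Shearing the plane so that u becomes horizontal, every
    nonempty horizontal slice of T is a segment which the sweep lengthens by
    r |cos th|; hence the sweep has area |T| + r w(u), where w(u) is the width
    of T across u.  By convexity, almost every height in the projection of T
    is crossed upwards by exactly one edge, so w(u) is half the sum of the
    lengths of the projected edges.  Integrating |a cos th + b sin th| over a
    period gives 4 |(a, b)|, whence the total volume 2 pi |T| + 2 r L(T).  The
    sweep is closed, hence measurable, by compactness of [0, r]. *)

Set Implicit Arguments.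
Unset Strict Implicit.
Unset Printing Implicit Defensive.

(** * Integral of [|a cos t + b sin t|] over a period *)

Section trigonometric_integral.
Variable R : realType.
Local Notation mu := (@lebesgue_measure R).

Definition trig (a b t : R) : R := a * cos t + b * sin t.
Definition trig_prim (a b t : R) : R := a * sin t - b * cos t.

Lemma continuous_trig (a b : R) : continuous (trig a b).
Proof.
move=> t; apply: cvgD; apply: cvgM; try exact: cvg_cst.
  exact: continuous_cos.
exact: continuous_sin.
Qed.

Lemma is_derive_trig_prim (a b t : R) :
  is_derive t 1 (trig_prim a b) (trig a b t).
Proof.
rewrite /trig_prim; apply: is_derive_eq.
rewrite /trig /GRing.scale /=; ring.
Qed.

(** The fundamental theorem of calculus. The half-open form lets consecutive pieces of the period be
    disjoint. *)
Lemma integral_trig (a b u w : R) : u <= w ->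
  (\int[mu]_(t in `[u, w[) (trig a b t)%:E =
  (trig_prim a b w - trig_prim a b u)%:E)%E.
Proof.
rewrite le_eqVlt => /predU1P[->|uw].
  by rewrite subrr set_itvco0 integral_set0.
have cP : continuous (trig_prim a b).
  move=> t; apply: differentiable_continuous; apply/derivable1_diffP.
  by have [] := is_derive_trig_prim a b t.
rewrite integral_itv_bndo_bndc.
- rewrite (continuous_FTC2 (F := trig_prim a b)) ?EFinB//.
  + exact/continuous_subspaceT/continuous_trig.
  + split; last 2 first.
    * by apply: cvg_at_right_filter; exact: cP.
    * by apply: cvg_at_left_filter; exact: cP.
    * by move=> t _; have [] := is_derive_trig_prim a b t.
  + by move=> t _; rewrite derive1E; have [_ ->] := is_derive_trig_prim a b t.
- apply/measurable_EFinP; apply: measurable_funTS.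
  by apply: continuous_measurable_fun; exact: continuous_trig.
Qed.

Lemma integral_norm_trig_ge0 (a b u w : R) : u <= w ->
  (forall t, u <= t <= w -> 0 <= trig a b t) ->
  (\int[mu]_(t in `[u, w[) (`|trig a b t|)%:E =
  (trig_prim a b w - trig_prim a b u)%:E)%E.
Proof.
move=> uw f0; rewrite -integral_trig//; apply: eq_integral => t.
rewrite inE/= in_itv/= => /andP[ut tw].
by rewrite ger0_norm// f0// ut ltW.
Qed.

Lemma trigN (a b t : R) : trig (- a) (- b) t = - trig a b t.
Proof. by rewrite /trig; ring. Qed.

Lemma trig_primN (a b t : R) : trig_prim (- a) (- b) t = - trig_prim a b t.
Proof. by rewrite /trig_prim; ring. Qed.

Lemma integral_norm_trig_le0 (a b u w : R) : u <= w ->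
  (forall t, u <= t <= w -> trig a b t <= 0) ->
  (\int[mu]_(t in `[u, w[) (`|trig a b t|)%:E =
  (trig_prim a b u - trig_prim a b w)%:E)%E.
Proof.
move=> uw f0.
have := @integral_norm_trig_ge0 (- a) (- b) u w uw.
under eq_integral do rewrite trigN normrN.
rewrite !trig_primN => ->; first by congr EFin; ring.
by move=> t /f0; rewrite trigN oppr_ge0.
Qed.

(** The values at 0 and [pi] are opposite, so there is a zero [z] in between, and the sign can
    change only at [z] and [z + pi]. The primitive is [- g] at [z], [g] at [z + pi], and takes equal
    values at 0 and [2 * pi]; the three pieces therefore add up to [4 * |g|]. *)
Lemma integral_norm_trig (a b : R) :
  (\int[mu]_(t in `[0%R, (2 * pi)%R[) (`|trig a b t|)%:E =
  (4 * Num.sqrt (a ^+ 2 + b ^+ 2))%:E)%E.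
Proof.
have pi0 := pi_ge0 R.
(* a zero [z] of the integrand in [[0, pi]], so that
   [trig a b (z + t) = g * sin t] *)
have [z /[!in_itv]/= /andP[z0 zpi] fz] :
    exists2 z, z \in `[0%R, pi]%R & trig a b z = 0.
  apply: IVT => //; first exact/continuous_subspaceT/continuous_trig.
  rewrite /trig cos0 sin0 cospi sinpi.
  by rewrite !mulr0 !addr0 mulr1 mulrN1; case: (lerP a (- a)) => ?; lra.
pose g := - a * sin z + b * cos z.
have gE : trig_prim a b z = - g by rewrite /trig_prim /g; ring.
have fE t : trig a b t = g * sin (t - z).
  rewrite -[in LHS](subrK z t) /trig (cosD (t - z)) (sinD (t - z) z).
  transitivity (cos (t - z) * trig a b z + g * sin (t - z)).
    by rewrite /trig /g; ring.
  by rewrite fz; ring.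
(* A rotation by [z] takes [(a, b)] to the pair [(trig a b z, g) = (0, g)] and preserves the
   norm. *)
have sqrtE : Num.sqrt (a ^+ 2 + b ^+ 2) = `|g|.
  rewrite -sqrtr_sqr; congr Num.sqrt.
  transitivity ((a ^+ 2 + b ^+ 2) * (cos z ^+ 2 + sin z ^+ 2)).
    by rewrite cos2Dsin2 mulr1.
  transitivity (g ^+ 2 + trig a b z ^+ 2); last by rewrite fz; ring.
  by rewrite /g /trig; ring.
have s1 t : 0 <= t <= z -> sin (t - z) <= 0.
  move=> ?; rewrite -oppr_ge0 -sinN; apply: sin_ge0_pi; lra.
have s2 t : z <= t <= z + pi -> 0 <= sin (t - z).
  by move=> ?; apply: sin_ge0_pi; lra.
have s3 t : z + pi <= t <= 2 * pi -> sin (t - z) <= 0.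
  move=> ?; have -> : t - z = (t - z - pi) + pi by ring.
  by rewrite sinDpi oppr_le0; apply: sin_ge0_pi; lra.
have mf (D : set R) : measurable_fun D (fun t => (`|trig a b t|)%:E).
  apply/measurable_EFinP; apply: measurable_funTS; apply: measurableT_comp => //.
  by apply: continuous_measurable_fun; exact: continuous_trig.
have -> : `[0%R, (2 * pi)%R[%classic =
    `[0%R, z[ `|` (`[z, z + pi[ `|` `[z + pi, (2 * pi)%R[) :> set R.
  apply/seteqP; split => t /=; rewrite !in_itv/=.
    move=> ?; have [?|?] := ltP t z; first by left; lra.
    by right; have [?|?] := ltP t (z + pi); [left|right]; lra.
  by move=> [|[]] ?; lra.
have m12 : [disjoint (`[0%R, z[%classic : set R) & `[z, z + pi[ `|` `[z + pi, (2 * pi)%R[].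
  apply/disj_setPS => t /= []; rewrite !in_itv/=.
  by move=> ? []?; lra.
have m23 : [disjoint (`[z, z + pi[%classic : set R) & `[z + pi, (2 * pi)%R[%classic].
  by apply/disj_setPS => t /= []; rewrite !in_itv/=; lra.
rewrite ge0_integral_setU//=; [|exact: measurableU|exact: mf].
rewrite ge0_integral_setU//=; last exact: mf.
have FD : trig_prim a b (z + pi) = g.
  by rewrite /trig_prim sinDpi cosDpi /g; ring.
have F2 : trig_prim a b (2 * pi) = trig_prim a b 0.
  by rewrite /trig_prim mulr_natl sin2pi cos2pi sin0 cos0.
rewrite sqrtE.
have [g0|g0] := leP 0 g.
  rewrite integral_norm_trig_le0//; last first.
    by move=> t /s1 ?; rewrite fE mulr_ge0_le0.
  rewrite integral_norm_trig_ge0//; [|lra|]; last first.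
    by move=> t /s2 ?; rewrite fE mulr_ge0.
  rewrite integral_norm_trig_le0//; [|lra|]; last first.
    by move=> t /s3 ?; rewrite fE mulr_ge0_le0.
  by rewrite -!EFinD gE FD F2 ger0_norm//; congr EFin; ring.
have {}g0 := ltW g0.
rewrite integral_norm_trig_ge0//; last first.
  by move=> t /s1 ?; rewrite fE mulr_le0.
rewrite integral_norm_trig_le0//; [|lra|]; last first.
  by move=> t /s2 ?; rewrite fE mulr_le0_ge0.
rewrite integral_norm_trig_ge0//; [|lra|]; last first.
  by move=> t /s3 ?; rewrite fE mulr_le0.
by rewrite -!EFinD gE FD F2 ler0_norm//; congr EFin; ring.
Qed.

End trigonometric_integral.

(** * Vertices and convexity of the polygon *)

Section polygon_convexity.
Variables (R : realType) (n : nat) (v : nat -> R * R).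

Lemma polygon_vertex i : (i < n)%N -> polygon n v (v i).
Proof.
move=> ilt; exists (fun j => (j == i)%:R); split; first by move=> j; exact: ler0n.
have sumE (f : nat -> R) : \sum_(j < n) (val j == i)%:R * f j = f i.
  rewrite (bigD1 (Ordinal ilt))//= eqxx mul1r big1 ?addr0// => j.
  by rewrite -val_eqE/= => /negPf ->; rewrite mul0r.
split; last by rewrite (sumE (fst \o v)) (sumE (snd \o v)) -surjective_pairing.
by rewrite -[RHS](sumE (fun=> 1)); apply: eq_bigr => j _; rewrite mulr1.
Qed.

Lemma polygon_convex (p q : R * R) (s t : R) :
  polygon n v p -> polygon n v q -> 0 <= s -> 0 <= t -> s + t = 1 ->
  polygon n v (s * p.1 + t * q.1, s * p.2 + t * q.2).
Proof.
move=> [w [w0 [w1 ->]]] [w' [w'0 [w'1 ->]]] s0 t0 st.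
exists (fun i => s * w i + t * w' i); split.
  by move=> i; rewrite addr_ge0// mulr_ge0.
split; first by rewrite big_split/= -!mulr_sumr w1 w'1 !mulr1.
by congr pair; rewrite !mulr_sumr -big_split/=; apply: eq_bigr => i _; ring.
Qed.

End polygon_convexity.

(** * Length of the projection of a convex polygon *)

Section polygon_projection.
Variable R : realType.
Variables (n : nat) (v : nat -> R * R) (m : R).
Local Notation mu := (@lebesgue_measure R).

Let next i := (i.+1 %% n)%N.
(** Height of a vertex after the shear that makes the lines of slope [m] horizontal. *)
Let h i : R := (v i).2 - m * (v i).1.

(** The shear [(x, y) -> (x, y - m * x)] has determinant 1, so orientation can be read off the
    heights [h]. *)
Lemma cross3_shear (a b c : R * R) : cross3 a b c =
  (b.1 - a.1) * ((c.2 - m * c.1) - (a.2 - m * a.1)) -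
  ((b.2 - m * b.1) - (a.2 - m * a.1)) * (c.1 - a.1).
Proof. by rewrite /cross3; ring. Qed.

(** Walk along the cycle from [i]: the edge that ends at the first vertex of height at least [y]
    crosses [y] upwards. *)
Lemma cyclic_crossing (i j : nat) (y : R) : (i < n)%N -> (j < n)%N ->
  h i < y -> y <= h j -> exists2 k, (k < n)%N & h k < y <= h (next k).
Proof.
move=> ilt jlt hi hj.
have n0 : (0 < n)%N by exact: leq_ltn_trans ilt.
have ex : exists t, y <= h ((i + t) %% n)%N.
  (* The added [n] keeps the natural subtraction from truncating when [j < i], and disappears modulo
     [n]. *)
  exists (j + n - i)%N; rewrite subnKC.
    by rewrite modnDr modn_small.
  by rewrite (leq_trans (ltnW ilt))// leq_addl.
case: (ex_minnP ex) => -[|t] yt tmin.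
  by move: yt; rewrite addn0 modn_small// leNgt hi.
exists ((i + t) %% n)%N; first by rewrite ltn_mod.
rewrite /next -addn1 modnDml addn1 -addnS yt andbT ltNge.
by apply/negP => /tmin; rewrite ltnn.
Qed.

Hypothesis cvx : convex_polygon_vertices n v.

Let n_gt0 : (0 < n)%N. Proof. by case: cvx => + _; exact: leq_trans. Qed.

Let next_inj i j : (i < n)%N -> (j < n)%N -> next i = next j -> i = j.
Proof.
move=> ilt jlt; rewrite /next => /eqP; rewrite -[i.+1]addn1 -[j.+1]addn1.
by rewrite eqn_modDr !modn_small// => /eqP.
Qed.

(** The two endpoints of the edge, where [cross3] vanishes, are now included. *)
Let cross3_ge0 i j : (i < n)%N -> (j < n)%N ->
  0 <= cross3 (v i) (v (next i)) (v j).
Proof.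
move=> ilt jlt; have [->|/eqP ji] := eqVneq j i.
  by rewrite /cross3 le_eqVlt; apply/orP; left; apply/eqP; ring.
have [->|/eqP jSi] := eqVneq j (next i); first
  by rewrite /cross3 le_eqVlt; apply/orP; left; apply/eqP; ring.
by apply: ltW; case: cvx => _; exact.
Qed.

(* Were two edges to cross the height [y] upwards, each of the two crossing
   points would lie strictly to the left of the other edge. *)
Let crossing_lt k l (y : R) : (k < n)%N -> (l < n)%N -> k != l ->
  h k < y <= h (next k) -> h l < y <= h (next l) ->
  (h (next k) - h k) *
    ((h (next l) - y) * (v l).1 + (y - h l) * (v (next l)).1) <
  (h (next l) - h l) *
    ((h (next k) - y) * (v k).1 + (y - h k) * (v (next k)).1).
Proof.
move=> klt llt kl /andP[k1 k2] /andP[l1 l2].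
have c1 := cross3_ge0 klt llt.
(* Strictness: [next l] is not [k], whose height is below [y], and is not [next k], since [next] is
   injective. *)
have c2 : 0 < cross3 (v k) (v (next k)) (v (next l)).
  case: cvx => _; apply => //; first by rewrite ltn_mod.
  - by move=> E; move: l2; rewrite E leNgt k1.
  - by move=> /next_inj E; move: kl; rewrite E ?eqxx.
(* [cross3] is affine in its last argument, so weighting [v l] and [v (next l)] by their height gaps
   to [y] tests the crossing point of edge [l]. The positive weight falls on the strict inequality
   [c2]. *)
move: c1 c2; rewrite !cross3_shear -!/(h _) => c1 c2.
have a0 : 0 <= h (next l) - y by rewrite subr_ge0.
have b0 : 0 < y - h l by rewrite subr_gt0.
have := mulr_ge0 a0 c1; have := mulr_gt0 b0 c2.
lra.
Qed.

(** For distinct edges [crossing_lt] would hold in both orders, which is contradictory. *)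
Lemma upward_crossing_unique k l (y : R) : (k < n)%N -> (l < n)%N ->
  h k < y <= h (next k) -> h l < y <= h (next l) -> k = l.
Proof.
move=> klt llt hk hl; apply/eqP/negPn/negP => kl.
have := crossing_lt klt llt kl hk hl.
rewrite eq_sym in kl; have := crossing_lt llt klt kl hl hk; lra.
Qed.

(** Projection along the direction [(1, m)]: the intercepts of the lines of slope [m] that meet the
    polygon. *)
Let proj : set R := [set y | exists x, polygon n v (x, y + m * x)].

(** A height in the projection is a weighted mean of vertex heights, so it is either the lowest one,
    [y0], or is crossed upwards by an edge. The intervals of the other edges are empty, and leaving
    out the lower endpoints avoids counting a shared vertex twice. *)
Lemma polygon_projE : exists y0, proj =
  y0 |` \big[setU/set0]_(k < n) `]h k, h (next k)]%classic.
Proof.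
have [i0 _ i0min] := Order.TotalTheory.arg_minP
  (fun i : 'I_n => h i) (erefl : xpredT (Ordinal n_gt0)).
exists (h i0); rewrite -(bigcup_mkord n (fun k => `]h k, h (next k)]%classic)).
 apply/seteqP; split => [y|y].
- move=> [x [w [w0 [w1 [xE yE]]]]].
  have {}yE : y = \sum_(i < n) w i * h i.
    under eq_bigr do rewrite /h mulrBr mulrCA.
    rewrite sumrB -mulr_sumr -xE -yE; ring.
  have hy : h i0 <= y.
    rewrite yE -[leLHS]mul1r -w1 mulr_suml; apply: ler_sum => i _.
    by rewrite ler_wpM2l// i0min.
  move: hy; rewrite le_eqVlt => /predU1P[->|hy]; [by left|right].
  have [j yj] : exists j : 'I_n, y <= h j.
    apply: contrapT => /forallNP yh.
    (* One positive weight is what makes the comparison of weighted means strict. *)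
    have [i wi] : exists i : 'I_n, 0 < w i.
      apply: contrapT => /forallNP wN.
      have : \sum_(i < n) w i = 0 :> R.
        by apply: big1 => i _; apply/eqP; rewrite eq_le w0 andbT leNgt; exact/negP.
      by rewrite w1 => /eqP; rewrite oner_eq0.
    suff : y < y by rewrite ltxx.
    rewrite {1}yE -[ltRHS]mul1r -w1 mulr_suml [ltLHS](bigD1 i)//= [ltRHS](bigD1 i)//=.
    apply: ltr_leD.
      by rewrite ltr_pM2l// ltNge; exact/negP.
    by apply: ler_sum => k _; rewrite ler_wpM2l// ltW// ltNge; exact/negP.
  have [k kn hk] := cyclic_crossing (ltn_ord i0) (ltn_ord j) hy yj.
  by exists k => //=; rewrite in_itv.
- have vE i : v i = ((v i).1, h i + m * (v i).1).
    by rewrite /h subrK -surjective_pairing.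
  move=> [->|[k /= kn]].
    by exists (v i0).1; rewrite -vE; exact: polygon_vertex.
  rewrite in_itv/= => /andP[hky yhk].
  have d0 : 0 < h (next k) - h k by lra.
  have nk : (next k < n)%N by rewrite ltn_mod.
  pose d := h (next k) - h k.
  pose s := (h (next k) - y) / d; pose t := (y - h k) / d.
  have s0 : 0 <= s by apply: divr_ge0; rewrite /d; lra.
  have t0 : 0 <= t by apply: divr_ge0; rewrite /d; lra.
  have st : s + t = 1 by rewrite /s /t /d; field; rewrite gt_eqF.
  have yE : s * h k + t * h (next k) = y.
    by rewrite /s /t /d; field; rewrite gt_eqF.
  have Tst := polygon_convex (polygon_vertex v kn) (polygon_vertex v nk) s0 t0 st.
  exists (s * (v k).1 + t * (v (next k)).1).
  suff <- : s * (v k).2 + t * (v (next k)).2 =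
      y + m * (s * (v k).1 + t * (v (next k)).1) by [].
  by rewrite -[in RHS]yE /h; ring.
Qed.

Lemma measurable_polygon_proj : measurable proj.
Proof.
have [y0 ->] := polygon_projE; apply: measurableU => //.
by apply: bigsetU_measurable => i _; exact: measurable_itv.
Qed.

(** Up to the null set [y0], the projection is a disjoint union of intervals. The length of each is
    the positive part [(|d| + d) / 2] of the height difference [d] of its edge, and these
    differences sum to zero around the cycle. *)
Lemma lebesgue_measure_polygon_proj :
  mu proj = (2^-1 * \sum_(k < n) `|h (next k) - h k|)%:E.
Proof.
have sum_next : \sum_(k < n) (h (next k) - h k) = 0.
  rewrite sumrB; apply/eqP; rewrite subr_eq0; apply/eqP.
  rewrite /next; case: n n_gt0 => // n' _.
  rewrite big_ord_recr/= modnn addrC [RHS]big_ord_recl/=; congr (_ + _).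
  by apply: eq_bigr => i _; rewrite modn_small// ltnS ltn_ord.
have [y0 projE] := polygon_projE.
have mU : measurable (\big[setU/set0]_(k < n) `]h k, h (next k)]%classic).
  by apply: bigsetU_measurable => i _; exact: measurable_itv.
have -> : mu proj = mu (\big[setU/set0]_(k < n) `]h k, h (next k)]%classic).
  apply/eqP; rewrite eq_le; apply/andP; split.
    rewrite projE (le_trans (measureU2 _ _ _))//.
    by rewrite [X in (X + _)%E]lebesgue_measure_set1 add0e.
  by apply: le_measure; rewrite ?inE//; [exact: measurable_polygon_proj
    |rewrite projE; exact: subsetUr].
rewrite measure_bigsetU_ord//; last first.
  apply/trivIsetP => i j _ _ ij; rewrite -subset0 => y []/=; rewrite !in_itv/= => yi yj.
  by move/eqP: ij; apply; apply: val_inj; exact: upward_crossing_unique yi yj.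
rewrite (eq_bigr (fun k : 'I_n =>
  (2^-1 * (`|h (next k) - h k| + (h (next k) - h k)))%:E)); last first.
  move=> k _; rewrite [LHS]lebesgue_measure_itv/= lte_fin.
  case: ltP => kn; rewrite -?EFinB; congr EFin.
    by rewrite ger0_norm ?subr_ge0 1?ltW//; field.
  by rewrite ler0_norm ?subr_le0//; ring.
by rewrite sumEFin -mulr_sumr big_split/= sum_next addr0.
Qed.

End polygon_projection.

(** * Compactness of the polygon, closedness and measurability of the sweep *)

Lemma continuous_at_pair (T U V : topologicalType) (f : T -> U) (g : T -> V)
    (z : T) : {for z, continuous f} -> {for z, continuous g} ->
  {for z, continuous (fun x => (f x, g x))}.
Proof. by move=> cf cg; exact: (cvg_pair cf cg). Qed.

Section topology.
Variable R : realType.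

Lemma nbhs_rat_itv (x : R) (A : set R) : nbhs x A ->
  exists q : rat * rat, `]ratr q.1, ratr q.2[%classic x /\
    `]ratr q.1, ratr q.2[%classic `<=` A.
Proof.
move=> /nbhs_ballP[e /= e0 eA].
have [p /[!in_itv]/= /andP[p1 p2]] :
  exists q, ratr q \in `]x - e, x[%R by apply: rat_in_itvoo; lra.
have [q /[!in_itv]/= /andP[q1 q2]] :
  exists q, ratr q \in `]x, x + e[%R by apply: rat_in_itvoo; lra.
exists (p, q); split; first by rewrite /= in_itv/= p2.
move=> y /=; rewrite in_itv/= => /andP[py yq]; apply: eA.
rewrite /ball/= ltr_norml; lra.
Qed.

Let box (q : (rat * rat) * (rat * rat) * (rat * rat)) : set ((R * R) * R) :=
  (`]ratr q.1.1.1, ratr q.1.1.2[ `*` `]ratr q.1.2.1, ratr q.1.2.2[) `*`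
  `]ratr q.2.1, ratr q.2.2[.

(** An open set is the union of the rational boxes inside it, which are countably many and
    measurable. *)
Lemma open_measurable3 (U : set ((R * R) * R)) : open U -> measurable U.
Proof.
move=> oU.
have -> : U = \bigcup_q (if `[< box q `<=` U >] then box q else set0).
  apply/seteqP; split => [[[x y] z] Uz|t [q _]]; last first.
    by case: ifPn => // /asboolP + qt; exact.
  have /= [[A B] /= [[[A1 A2] /= [A1x A2y]] A12 Bz] ABU] := open_nbhs_nbhs (conj oU Uz).
  have [q1 [q1x q1A]] := nbhs_rat_itv A1x.
  have [q2 [q2y q2A]] := nbhs_rat_itv A2y.
  have [q3 [q3z q3B]] := nbhs_rat_itv Bz.
  exists (q1, q2, q3) => //.
  rewrite ifT//; apply/asboolP => -[[x' y'] z'] [[/= x'q y'q] z'q].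
  by apply: ABU; split => /=; [apply: A12; split; [exact: q1A|exact: q2A]|exact: q3B].
apply: countable_bigcupT_measurable => // q; case: ifP => // _.
by apply: measurableX => //; apply: measurableX.
Qed.

Lemma closed_measurable3 (A : set ((R * R) * R)) : closed A -> measurable A.
Proof. by move=> /closed_openC/open_measurable3/measurableC; rewrite setCK. Qed.

(* A polygon is the slice of total weight 1 of this sum of segments, whose
   compactness follows by induction on the number of vertices. *)
Let zonotope n (v : nat -> R * R) : set (R * (R * R)) :=
  [set z | exists w : nat -> R, (forall i, (i < n)%N -> 0 <= w i <= 1) /\
    z = (\sum_(i < n) w i,
         (\sum_(i < n) w i * (v i).1, \sum_(i < n) w i * (v i).2))].

Let compact_zonotope n (v : nat -> R * R) : compact (zonotope n v).
Proof.
elim: n => [|n IH].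
  have -> : zonotope 0 v = [set (0, (0, 0))]; last exact: compact_set1.
  apply/seteqP; split => [z [w [_ ->]]|z ->]; first by rewrite !big_ord0.
  by exists (fun=> 0); split => //; rewrite !big_ord0.
(* Adds the segment from the origin to [(1, v n)]: the new zonotope is a continuous image of a
   product of compact sets. *)
pose f (z : (R * (R * R)) * R) : R * (R * R) :=
  (z.1.1 + z.2, (z.1.2.1 + z.2 * (v n).1, z.1.2.2 + z.2 * (v n).2)).
have -> : zonotope n.+1 v = f @` (zonotope n v `*` `[0, 1]).
  apply/seteqP; split => [_ [w [w01 ->]]|_ [[z t] [/= [w [w01 ->]] t01] <-]].
    exists ((\sum_(i < n) w i,
         (\sum_(i < n) w i * (v i).1, \sum_(i < n) w i * (v i).2)), w n).
      split => /=; last by rewrite in_itv/= w01.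
      by exists w; split => // i ilt; apply: w01; rewrite ltnS ltnW.
    by rewrite /f /= !big_ord_recr.
  rewrite in_itv/= in t01.
  exists (fun i => if i == n then t else w i); split.
    by move=> i; rewrite ltnS leq_eqVlt; case: eqVneq => //= _; exact: w01.
  rewrite /f !big_ord_recr/= eqxx.
  by congr (_ + _, (_ + _, _ + _)); apply: eq_bigr => i _;
    rewrite ltn_eqF.
apply: continuous_compact; last first.
  by apply: compact_setX => //; exact: segment_compact.
apply: continuous_subspaceT => z.
have c1 : {for z, continuous (fun z : (R * (R * R)) * R => z.1)} by exact: cvg_fst.
have c2 : {for z, continuous (fun z : (R * (R * R)) * R => z.2)} by exact: cvg_snd.
have c11 : {for z, continuous (fun z : (R * (R * R)) * R => z.1.1)}.
  by apply: continuous_comp; [exact: c1|exact: cvg_fst].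
have c12 : {for z, continuous (fun z : (R * (R * R)) * R => z.1.2)}.
  by apply: continuous_comp; [exact: c1|exact: cvg_snd].
have c121 : {for z, continuous (fun z : (R * (R * R)) * R => z.1.2.1)}.
  by apply: continuous_comp; [exact: c12|exact: cvg_fst].
have c122 : {for z, continuous (fun z : (R * (R * R)) * R => z.1.2.2)}.
  by apply: continuous_comp; [exact: c12|exact: cvg_snd].
have cD : {for z, continuous (fun z : (R * (R * R)) * R => z.1.1 + z.2)}.
  exact: cvgD.
have cx : {for z, continuous
    (fun z : (R * (R * R)) * R => z.1.2.1 + z.2 * (v n).1)}.
  by apply: cvgD => //; apply: cvgM => //; exact: cvg_cst.
have cy : {for z, continuous
    (fun z : (R * (R * R)) * R => z.1.2.2 + z.2 * (v n).2)}.
  by apply: cvgD => //; apply: cvgM => //; exact: cvg_cst.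
exact: continuous_at_pair cD (continuous_at_pair cx cy).
Qed.

Lemma compact_polygon n (v : nat -> R * R) : compact (polygon n v).
Proof.
have -> : polygon n v = snd @` (zonotope n v `&` (fst @^-1` [set 1])).
  apply/seteqP; split => [_ [w [w0 [w1 ->]]]|_ [_ [[w [w01 ->]] /= w1] <-]].
    exists (\sum_(i < n) w i,
         (\sum_(i < n) w i * (v i).1, \sum_(i < n) w i * (v i).2)) => //.
    split => //; exists w; split => // i ilt; rewrite w0/= -w1.
    by rewrite (bigD1 (Ordinal ilt))//= lerDl sumr_ge0.
  (* [polygon] asks for nonnegative weights at every index, the zonotope only below [n]; hence the
     extension by 0. *)
  exists (fun i => if (i < n)%N then w i else 0); split.
    by move=> i; case: ifPn => // /w01/andP[].
  by split; [rewrite -w1|congr pair]; apply: eq_bigr => i _; rewrite ltn_ord.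
apply: continuous_compact; first by apply: continuous_subspaceT => z; exact: cvg_snd.
apply: compact_closedI; first exact: compact_zonotope.
apply: preimage_closed => [z _|]; first exact: cvg_fst.
exact: closed_eq.
Qed.

Lemma closed_polygon n (v : nat -> R * R) : closed (polygon n v).
Proof. by apply: compact_closed; [exact: norm_hausdorff|exact: compact_polygon]. Qed.

(** The detection event freed of the minimum. Position and angle are kept together so that one
    closedness argument gives joint measurability. *)
Definition sweep (T : set (R * R)) (r : R) : set ((R * R) * R) :=
  [set z | exists t, 0 <= t <= r /\
     T (z.1.1 + t * cos z.2, z.1.2 + t * sin z.2)].

Let move_along (tz : R * ((R * R) * R)) : R * R :=
  (tz.2.1.1 + tz.1 * cos tz.2.2, tz.2.1.2 + tz.1 * sin tz.2.2).

Let continuous_move_along : continuous move_along.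
Proof.
move=> z.
pose A : Type := R * ((R * R) * R).
have c1 : {for z, continuous (fun z : A => z.1)} by exact: cvg_fst.
have c2 : {for z, continuous (fun z : A => z.2)} by exact: cvg_snd.
have c21 : {for z, continuous (fun z : A => z.2.1)}.
  by apply: continuous_comp; [exact: c2|exact: cvg_fst].
have c22 : {for z, continuous (fun z : A => z.2.2)}.
  by apply: continuous_comp; [exact: c2|exact: cvg_snd].
have c211 : {for z, continuous (fun z : A => z.2.1.1)}.
  by apply: continuous_comp; [exact: c21|exact: cvg_fst].
have c212 : {for z, continuous (fun z : A => z.2.1.2)}.
  by apply: continuous_comp; [exact: c21|exact: cvg_snd].
have cx : {for z, continuous (fun z : A => z.2.1.1 + z.1 * cos z.2.2)}.
  apply: cvgD => //; apply: cvgM => //.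
  by apply: continuous_comp; [exact: c22|exact: continuous_cos].
have cy : {for z, continuous (fun z : A => z.2.1.2 + z.1 * sin z.2.2)}.
  apply: cvgD => //; apply: cvgM => //.
  by apply: continuous_comp; [exact: c22|exact: continuous_sin].
exact: continuous_at_pair cx cy.
Qed.

(** If no [t] in [[0, r]] reaches [T] from [z], then near each [(t, z)] the moved point still avoids
    [T]; compactness makes the neighbourhood of [z] uniform in [t]. *)
Lemma closed_sweep (T : set (R * R)) (r : R) : closed T -> closed (sweep T r).
Proof.
move=> cT; rewrite -[sweep T r]setCK; apply: open_closedC.
rewrite openE => z zN.
have := (compact_near_coveringP _).1 (@segment_compact R 0 r) _ (nbhs z)
  (fun z t => ~ T (move_along (t, z))) _.
move=> /(_ _) H; apply: filterS (H _) => [z' z'N [t [t0r /z'N]]|].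
  by apply; rewrite /= in_itv.
move=> t /=; rewrite in_itv/= => t0r.
have oT : nbhs (move_along (t, z)) (~` T).
  apply: open_nbhs_nbhs; split; first exact: closed_openC.
  by move=> Tz; apply: zN; exists t.
exact: continuous_move_along oT.
Qed.

(** The hit set is compact, so as soon as it contains some [t <= r] its minimum is attained and is
    at most [r]. *)
Lemma detect_leE (T : set (R * R)) (rmax r : R) (z : (R * R) * R) :
  closed T -> r <= rmax -> detect_le T rmax r z.1 z.2 <-> sweep T r z.
Proof.
move=> cT rr; split => [[s [[/andP[s0 _] Ts] [_ sr]]]|[t [/andP[t0 tr] Tt]]].
  by exists s; rewrite s0.
pose H := hit_set T rmax z.1 z.2.
have Ht : H t by split => //; rewrite t0 (le_trans tr).
have cH : compact H.
  have -> : H = `[0, rmax] `&` (fun t => move_along (t, z)) @^-1` T.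
    by apply/seteqP; split => u; rewrite /H /hit_set /= in_itv.
  apply: compact_closedI; first exact: segment_compact.
  apply: preimage_closed => // u _.
  apply: continuous_comp; last exact: continuous_move_along.
  by apply: continuous_at_pair; [exact: cvg_id|exact: cvg_cst].
have cid : {within H, continuous (fun x : R => x)}.
  by apply: continuous_subspaceT => x; exact: cvg_id.
have [s /set_mem Hs smin] := compact_EVT_min (ex_intro _ _ Ht) cH cid.
exists s; split => //; split => [u Hu|]; first by apply: smin; exact: mem_set.
by rewrite (le_trans _ tr)// smin//; exact: mem_set.
Qed.

End topology.

(** * Slicing, shearing and stretching *)

Section area.
Variable R : realType.
Local Notation mu := (@lebesgue_measure R).

Lemma lebesgue_measure_segment (a b : R) : a <= b ->
  mu `[a, b]%classic = (b - a)%:E.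
Proof.
rewrite [mu _]lebesgue_measure_itv/= lte_fin le_eqVlt => /predU1P[->|->//].
by rewrite ltxx subrr.
Qed.

(** The pushforward of [mu] by the translation agrees with [mu] on half-open intervals, which
    determine the measure. *)
Lemma lebesgue_measure_shift (A : set R) (a : R) : measurable A ->
  mu [set y | A (y + a)] = mu A.
Proof.
move=> mA.
have mf : measurable_fun [set: measurableTypeR R] (fun y : R => y + a : measurableTypeR R).
  exact: measurable_funD.
have E := @lebesgue_measure_unique R
  (measure_function_pushforward__canonical__measure_function_Measure mu mf).
 apply/esym; apply: E => //.
move=> _ /ocitvP[->|[[u w] /= uw ->]]; first by rewrite !measure0.
change (mu `]u, w]%classic = mu ((fun y : R => y + a) @^-1` `]u, w])).
have -> : (fun y : R => y + a) @^-1` `]u, w] = `]u - a, w - a]%classic.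
  by apply/seteqP; split => y /=; rewrite !in_itv/=; lra.
rewrite [LHS]lebesgue_measure_itv [RHS]lebesgue_measure_itv/= !lte_fin.
rewrite ltrD2r; case: ifPn => // _.
by rewrite -!EFinD; congr EFin; ring.
Qed.

(** The product measures taken in either order agree on rectangles, hence everywhere. *)
Lemma area_ysection (A : set (R * R)) : measurable A ->
  area A = (\int[mu]_y mu (ysection A y))%E.
Proof.
move=> mA; rewrite /area.
by rewrite (product_measure_unique (m' := (mu \x^ mu)%E))// => ? ? ? ?;
  exact: product_measure2E.
Qed.

(** A name for the plane measure that carries its sigma-finiteness, with which [vol3] can be sliced
    by angle. *)
Definition plane_measure : set (measurableTypeR R * measurableTypeR R)%type ->
  \bar R := (mu \x mu)%E.

HB.instance Definition _ := Measure.on plane_measure.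

Let sigma_finite_plane_measure : sigma_finite setT plane_measure.
Proof.
pose I n : set R := `[- n%:R, n%:R]%classic.
exists (fun n => I n `*` I n) => [|n].
  apply/esym/seteqP; split => // -[x y] _.
  have := archi_boundP (addr_ge0 (normr_ge0 x) (normr_ge0 y)).
  set n := Num.bound _ => xy; exists n => //.
  have := normr_ge0 x; have := normr_ge0 y.
  by split; rewrite /I /= in_itv/= -ler_norml; lra.
have mI : measurable (I n) by exact: measurable_itv.
split; first exact: measurableX.
have In : mu (I n) = (n%:R - - n%:R)%:E.
  by rewrite lebesgue_measure_segment//; have := ler0n R n; lra.
have -> : plane_measure (I n `*` I n) = (mu (I n) * mu (I n))%E.
  exact: product_measure1E.
by rewrite In -EFinM ltry.
Qed.

HB.instance Definition _ := Measure_isSigmaFinite.Build _ _ _ plane_measure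
  sigma_finite_plane_measure.

Lemma vol3_ysection (A : set ((R * R) * R)) : measurable A ->
  vol3 A = (\int[mu]_y area (ysection A y))%E.
Proof.
move=> mA; transitivity ((plane_measure \x mu)%E A) => //.
by rewrite (product_measure_unique (m' := (plane_measure \x^ mu)%E))// => ? ? ? ?;
  exact: product_measure2E.
Qed.

Lemma measurable_shear (A : set (R * R)) (m : R) : measurable A ->
  measurable [set p : R * R | A (p.1, p.2 + m * p.1)].
Proof.
move=> mA; have mf : measurable_fun setT (fun p : R * R => (p.1, p.2 + m * p.1)).
  apply: measurable_fun_pair => //; apply: measurable_funD => //.
  exact: measurable_funM.
by rewrite -[X in measurable X]setTI; exact: mf.
Qed.

(** The shear translates each vertical section, so it preserves area; the sheared set is then sliced
    horizontally. *)
Lemma area_shear (A : set (R * R)) (m : R) : measurable A ->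
  area A = (\int[mu]_y mu [set x | A (x, (y + m * x)%R)])%E.
Proof.
move=> mA; pose A' := [set p : R * R | A (p.1, p.2 + m * p.1)].
have mA' : measurable A' by exact: measurable_shear.
transitivity (area A').
  apply: eq_integral => x _ /=.
  have -> : xsection A' x = [set y | xsection A x (y + m * x)].
    by apply/seteqP; split => y; rewrite /xsection/= !inE.
  by rewrite lebesgue_measure_shift//; exact: measurable_xsection.
rewrite area_ysection//; apply: eq_integral => y _; congr (mu _).
by apply/seteqP; split => x; rewrite /ysection/= inE.
Qed.

Lemma compact_convex_itv (S : set R) : S !=set0 -> compact S ->
  (forall x y s t, S x -> S y -> 0 <= s -> 0 <= t -> s + t = 1 ->
    S (s * x + t * y)) ->
  exists a b, a <= b /\ S = `[a, b]%classic.
Proof.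
move=> S0 cS convS.
have cid : {within S, continuous (fun x : R => x)}.
  by apply: continuous_subspaceT => x; exact: cvg_id.
have [a /set_mem Sa amin] := compact_EVT_min S0 cS cid.
have [b /set_mem Sb bmax] := compact_EVT_max S0 cS cid.
have ab : a <= b by apply: amin; exact: mem_set.
exists a, b; split => //; apply/seteqP; split => [x Sx|x] /=.
  by rewrite in_itv/=; apply/andP; split; [apply: amin|apply: bmax]; exact: mem_set.
rewrite in_itv/= => /andP[ax xb].
(* A one-point segment is set apart because the barycentric coordinates divide by [b - a]. *)
move: ab; rewrite le_eqVlt => /predU1P[abE|ab].
  by have -> : x = a by apply/eqP; rewrite eq_le ax andbT abE.
have d0 : b - a != 0 by rewrite subr_eq0 gt_eqF.
have -> : x = (b - x) / (b - a) * a + (x - a) / (b - a) * b by field.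
apply: convS => //; [by apply: divr_ge0; lra..|by field].
Qed.

(** [S] is a segment [[a, b]]; its translates by [- t * c] fill [[a - r * c, b]] or
    [[a, b - r * c]], according to the sign of [c]. *)
Lemma lebesgue_measure_stretch (S : set R) (r c : R) : 0 <= r ->
  S !=set0 -> compact S ->
  (forall x y s t, S x -> S y -> 0 <= s -> 0 <= t -> s + t = 1 ->
    S (s * x + t * y)) ->
  (mu [set x | exists t, (0 <= t <= r)%R /\ S (x + t * c)%R] =
  mu S + (r * `|c|)%:E)%E.
Proof.
move=> r0 S0 cS convS; have [a [b [ab ->]]] := compact_convex_itv S0 cS convS.
have [u [w [-> wE]]] : exists u w,
    [set x | exists t, 0 <= t <= r /\ `[a, b]%classic (x + t * c)] =
    `[u, w]%classic /\ w - u = b - a + r * `|c|.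
  have [c0|c0] := leP 0 c.
    exists (a - r * c), b; split; last by rewrite ger0_norm//; ring.
    apply/seteqP; split => [x [t [/andP[t0 tr]]]|x] /=; rewrite !in_itv/=.
      have := ler_wpM2r c0 t0; have := ler_wpM2r c0 tr; lra.
    move=> /andP[x1 x2]; have [ax|xa] := leP a x.
      by exists 0; rewrite lexx r0 in_itv/=; split => //; lra.
    have {}c0 : 0 < c by rewrite lt_neqAle c0 andbT; apply/eqP => cE; nra.
    (* The travel that brings [x] exactly to the endpoint [a]. *)
    exists ((a - x) / c); rewrite in_itv/= divfK ?gt_eqF//; split; last lra.
    by apply/andP; split; [apply: divr_ge0; lra|rewrite ler_pdivrMr//; lra].
  exists a, (b - r * c); split; last by rewrite ltr0_norm//; ring.
  apply/seteqP; split => [x [t [/andP[t0 tr]]]|x] /=; rewrite !in_itv/=.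
    have := ler_wnM2r (ltW c0) t0; have := ler_wnM2r (ltW c0) tr; lra.
  move=> /andP[x1 x2]; have [xb|bx] := leP x b.
    by exists 0; rewrite lexx r0 in_itv/=; split => //; lra.
  exists ((b - x) / c); rewrite in_itv/= divfK ?lt_eqF//; split; last lra.
  by rewrite ler_ndivrMr// ler_ndivlMr// mul0r; lra.
have uw : u <= w by have := mulr_ge0 r0 (normr_ge0 c); lra.
rewrite !lebesgue_measure_segment// -EFinD; congr EFin; lra.
Qed.

End area.

(** * Area of the sweep at a fixed angle, and its integral over the angles *)

Section swept_area.
Variables (R : realType) (n : nat) (v : nat -> R * R) (r : R).
Hypothesis cvx : convex_polygon_vertices n v.
Hypothesis r_ge0 : 0 <= r.
Local Notation mu := (@lebesgue_measure R).
Local Notation T := (polygon n v).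

Let next i := (i.+1 %% n)%N.

Lemma measurable_sweep : measurable (sweep T r).
Proof. by apply: closed_measurable3; apply: closed_sweep; exact: closed_polygon. Qed.

(** The polygon is the section at angle 0 of its own sweep of length 0. *)
Lemma measurable_polygon : measurable T.
Proof.
have mT : measurable (sweep T 0).
  by apply: closed_measurable3; apply: closed_sweep; exact: closed_polygon.
have -> : T = ysection (sweep T 0) 0; last exact: measurable_ysection.
apply/seteqP; split => [[x y] Txy|[x y]]; rewrite /ysection /= inE.
  by exists 0; rewrite lexx !mul0r !addr0.
move=> [t [/andP[t0 t1]]] /=.
by have -> : t = 0 by [apply/eqP; rewrite eq_le t0 t1]; rewrite !mul0r !addr0.
Qed.

Let slice m y : set R := [set x | T (x, y + m * x)].

Let compact_slice m y : compact (slice m y).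
Proof.
have -> : slice m y = fst @` (T `&` (fun p : R * R => p.2 - m * p.1) @^-1` [set y]).
  apply/seteqP; split => [x Tx|_ [[x z] /= [Txz <-] <-]].
    by exists (x, y + m * x) => //; split => //=; ring.
  by rewrite /slice /= subrK.
apply: continuous_compact; first by apply: continuous_subspaceT => p; exact: cvg_fst.
apply: compact_closedI; first exact: compact_polygon.
apply: preimage_closed => [p _|]; last exact: closed_eq.
apply: cvgB; first exact: cvg_snd.
by apply: cvgM; [exact: cvg_cst|exact: cvg_fst].
Qed.

Lemma area_sweep (th : R) : cos th != 0 ->
  area (ysection (sweep T r) th) =
  (area T + \sum_(k < n) (2^-1 * r * `|trig ((v (next k)).2 - (v k).2)
    ((v k).1 - (v (next k)).1) th|)%:E)%E.
Proof.
move=> c0; pose m := sin th / cos th.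
have mcE : m * cos th = sin th by rewrite /m divfK.
rewrite (area_shear m); last exact: measurable_ysection measurable_sweep.
rewrite (area_shear m measurable_polygon).
pose proj := [set y | exists x, T (x, y + m * x)].
have mproj : measurable proj by exact: measurable_polygon_proj.
(* The indicator is there because an empty slice stays empty: only heights in the projection gain
   length. *)
transitivity (\int[mu]_y (mu (slice m y) + (r * `|cos th|)%:E * (\1_proj y)%:E))%E.
  apply: eq_integral => y _.
  have -> : [set x | ysection (sweep T r) th (x, y + m * x)] =
      [set x | exists t, 0 <= t <= r /\ slice m y (x + t * cos th)].
    (* A move by [t] stays on the line of slope [m] and shifts the abscissa by [t * cos th]. *)
    have E x t : y + m * x + t * sin th = y + m * (x + t * cos th).
      by rewrite -mcE; ring.
    by apply/seteqP; split => x; rewrite /ysection /= inE /sweep /slice /=;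
      move=> [t H]; exists t; move: H; rewrite E.
  have [yproj|yproj] := pselect (proj y).
    rewrite lebesgue_measure_stretch//; first by rewrite indicE mem_set// mule1.
    move=> x x' s t Tx Tx' s0 t0 st.
    have := polygon_convex Tx Tx' s0 t0 st; rewrite /slice /=.
    have -> // : s * (y + m * x) + t * (y + m * x') = y + m * (s * x + t * x').
    by rewrite -[in RHS](mul1r y) -st; ring.
  have s0 : slice m y = set0 by rewrite -subset0 => x Tx; apply: yproj; exists x.
  rewrite indicE memNset// mule0 adde0; congr (mu _).
  by rewrite s0 -subset0 => x [t []].
have msl : measurable_fun setT (fun y => mu (slice m y)).
  have mT' := measurable_shear m measurable_polygon.
  rewrite (_ : (fun y => _) = (fun y =>
    mu (ysection [set p : R * R | T (p.1, p.2 + m * p.1)] y))).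
    exact: measurable_fun_ysection.
  apply/funext => y; congr (mu _).
  by apply/seteqP; split => x; rewrite /ysection /= inE.
have mproj1 : measurable_fun setT (fun y => (\1_proj y)%:E : \bar R).
  by apply/measurable_EFinP; exact: measurable_indic.
have rc0 : (0 <= (r * `|cos th|)%:E)%E by rewrite lee_fin mulr_ge0.
rewrite ge0_integralD//; last 2 first.
- by move=> y _; rewrite mule_ge0.
- exact: measurable_funeM.
congr (_ + _)%E.
rewrite ge0_integralZl// integral_indic// setIT.
rewrite [X in (_ * X)%E]lebesgue_measure_polygon_proj//.
rewrite sumEFin -EFinM mulrA mulr_sumr; congr EFin.
apply: eq_bigr => k _.
(* The factor [cos th] turns the sheared height of an edge into its extent across the direction of
   angle [th]. *)
have -> : trig ((v (next k)).2 - (v k).2) ((v k).1 - (v (next k)).1) th =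
    cos th * (((v (next k)).2 - m * (v (next k)).1) - ((v k).2 - m * (v k).1)).
  by rewrite /trig -mcE; ring.
by rewrite normrM; ring.
Qed.

(** Shows that the angles left out of [area_sweep] form a null set. Cosine is injective on
    [[0, pi]], and [th -> 2 * pi - th] reduces the other half to this one. *)
Lemma cos_eq0_itv (th : R) : 0 <= th < 2 * pi -> cos th = 0 ->
  th = pi / 2 \/ th = 3 * pi / 2.
Proof.
have pi0 := pi_gt0 R.
have pihalf : (pi / 2 : R) \in `[0, pi] by rewrite in_itv/=; lra.
move=> /andP[th0 th2] c0; have [thpi|thpi] := leP th pi.
  by left; apply: cos_inj => //; rewrite ?cos_pihalf// in_itv/= th0.
right; suff : 2 * pi - th = pi / 2 by lra.
apply: cos_inj => //; first by rewrite in_itv/=; lra.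
rewrite cos_pihalf cosB c0 (_ : 2 * pi = pi *+ 2) ?sin2pi; last by rewrite mulr_natl.
by rewrite mulr0 mul0r addr0.
Qed.

Lemma vol3_sweep : area T \is a fin_num ->
  vol3 [set z | sweep T r z /\ 0 <= z.2 < 2 * pi] =
  (2 * (r * perimeter n v + pi * fine (area T)))%:E.
Proof.
move=> fT.
have mI : measurable (`[0, 2 * pi[%classic : set R) by exact: measurable_itv.
rewrite vol3_ysection; last first.
  rewrite (_ : [set z | _] = sweep T r `&` snd @^-1` `[0%R, (2 * pi)%R[%classic).
    apply: measurableI; first exact: measurable_sweep.
    by rewrite -[X in measurable X]setTI; exact: measurable_snd.
  by apply/seteqP; split => z /=; rewrite in_itv/=; tauto.
pose f th := area (ysection (sweep T r) th).
pose g th := (area T + \sum_(k < n) (2^-1 * r * `|trig ((v (next k)).2 - (v k).2)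
    ((v k).1 - (v (next k)).1) th|)%:E)%E.
transitivity (\int[mu]_(th in `[0%R, (2 * pi)%R[) f th)%E.
  rewrite [RHS]integral_mkcond; apply: eq_integral => th _.
  rewrite patchE; case: ifPn => thI.
    congr (area _); apply/seteqP; split => p; rewrite /ysection /= !inE.
      by case.
    by move: thI; rewrite inE/= in_itv.
  rewrite (_ : ysection _ _ = set0) ?[LHS]measure0//.
  rewrite -subset0 => p; rewrite /ysection /= inE => -[_ /= thI'].
  by move/negP: thI; apply; rewrite inE/= in_itv.
have term_ge0 (k : 'I_n) th : (0 <= (2^-1 * r * `|trig ((v (next k)).2 - (v k).2)
    ((v k).1 - (v (next k)).1) th|)%:E)%E by rewrite lee_fin !mulr_ge0.
have mtrig (a b : R) : measurable_fun `[0%R, (2 * pi)%R[ (fun th => `|trig a b th|).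
  apply: measurable_funTS; apply: measurableT_comp => //.
  by apply: continuous_measurable_fun; exact: continuous_trig.
have mterm (k : 'I_n) : measurable_fun `[0%R, (2 * pi)%R[ (fun th =>
    (2^-1 * r * `|trig ((v (next k)).2 - (v k).2)
    ((v k).1 - (v (next k)).1) th|)%:E).
  apply/measurable_EFinP; apply: measurable_funM; last exact: mtrig.
  exact: measurable_cst.
(* [f] and [g] agree except possibly at the two zeros of cosine. *)
transitivity (\int[mu]_(th in `[0%R, (2 * pi)%R[) g th)%E.
  apply: ge0_ae_eq_integral => //.
  - apply: measurable_funTS.
    exact: (measurable_fun_ysection (@plane_measure R) measurable_sweep).
  - by apply: emeasurable_funD => //; apply: emeasurable_sum.
  - by move=> th _; rewrite adde_ge0 ?measure_ge0// sume_ge0.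
  - have N0 (x : R) : mu.-negligible [set x].
      by apply/negligibleP => //; exact: lebesgue_measure_set1.
    apply: negligibleS (negligibleU (N0 (pi / 2)) (N0 (3 * pi / 2))) => th /=.
    move=> /not_implyP[]; rewrite in_itv/= => thI fg.
    apply: cos_eq0_itv => //; apply/eqP/negPn/negP => c0.
    by apply: fg; exact: area_sweep.
rewrite ge0_integralD//; last 2 first.
- by move=> th _; rewrite sume_ge0.
- exact: emeasurable_sum.
rewrite ge0_integral_sum//.
(* The constant [2 * r] is [r / 2] from the projection times 4 from the trigonometric integral. *)
transitivity (area T * (2 * pi)%:E + \sum_(k < n) (2 * r * dist2 (v k) (v (next k)))%:E)%E.
  congr (_ + _)%E.
    transitivity (area T * mu `[0%R, (2 * pi)%R[%classic)%E.
      exact: integral_cst.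
    by rewrite [mu _]lebesgue_measure_itv/= lte_fin mulr_gt0 ?pi_gt0// oppr0 addr0.
  apply: eq_bigr => k _.
  under eq_integral do rewrite EFinM.
  rewrite ge0_integralZl//; last 2 first.
  - by apply/measurable_EFinP; exact: mtrig.
  - by rewrite lee_fin mulr_ge0.
  rewrite integral_norm_trig -EFinM /dist2; congr EFin.
  rewrite mulrA; congr (_ * _); first by field.
  by congr Num.sqrt; ring.
rewrite -{1}(fineK fT) sumEFin -EFinM -EFinD -mulr_sumr; congr EFin.
rewrite /perimeter; ring.
Qed.

End swept_area.

(** * The detection probability *)

Unset Implicit Arguments.

Theorem theorem1 (R : realType) (Omega : set (R * R)) (n : nat) (v : nat -> R * R)
  (rmax r : R) :
  measurable Omega ->
  (0 < area Omega)%E -> (area Omega < +oo)%E ->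
  convex_polygon_vertices n v ->
  polygon n v `<=` Omega ->
  0 < rmax ->
  (forall p, (exists q, polygon n v q /\ dist2 p q <= rmax) -> Omega p) ->
  0 <= r -> r <= rmax ->
  prob_detect_le Omega (polygon n v) rmax r =
    ((r * perimeter n v + pi * fine (area (polygon n v))) / (pi * fine (area Omega)))%:E.
Proof.
move=> mOmega Omega0 Omegaoo cvx TOmega _ rOmega r0 rrmax.
set T := polygon n v.
have fOmega : area Omega \is a fin_num by rewrite ge0_fin_numE// ltW.
have fT : area T \is a fin_num.
  rewrite ge0_fin_numE; last exact: measure_ge0.
  apply: le_lt_trans Omegaoo; apply: le_measure; rewrite ?inE//.
  exact: measurable_polygon.
rewrite /prob_detect_le.
have -> : [set z | Omega z.1 /\ 0 <= z.2 < 2 * pi /\ detect_le T rmax r z.1 z.2] =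
    [set z | sweep T r z /\ 0 <= z.2 < 2 * pi].
  apply/seteqP; split => z /= [].
    by move=> _ [? /(detect_leE z (@closed_polygon R n v) rrmax)].
  move=> sz th; split; last first.
    by split=> //; apply/(detect_leE z (@closed_polygon R n v) rrmax).
  (* A position that reaches [T] after a travel [t <= r] is at distance [t <= rmax] from the point
     reached, hence lies in [Omega]. *)
  case: sz => t [/andP[t0 tr] Tt]; apply: rOmega; eexists; split; first exact: Tt.
  rewrite /dist2 /= (_ : _ ^+ 2 + _ = t ^+ 2); last first.
    rewrite -[RHS]mulr1 -(cos2Dsin2 z.2); ring.
  by rewrite sqrtr_sqr ger0_norm// (le_trans tr).
rewrite vol3_sweep// -[in LHS](fineK fOmega) -EFinM inver.
(* The extended inverse distinguishes the case of a zero denominator; positivity selects the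
   ordinary inverse. *)
have A0 : 0 < fine (area Omega) by rewrite fine_gt0// Omega0.
have pi0 := pi_gt0 R.
rewrite gt_eqF ?mulr_gt0// -EFinM; congr EFin.
(* [field] would unfold [pi] to [_ *+ 2] *)
by move: (@pi R) pi0 => p p0; field; rewrite !gt_eqF.
Qed.
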